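(* Let $q$ be a prime power and let $m,n,r$ be positive integers. Then \[\frac{\mathrm{g}_{m}(n,q,r)}{|\mathrm{PGL}_n(\mathbb{F}_{q^r})|}= \sum_{s\mid r}\frac{\mathrm{g}_{m}(n,q^s)}{|\mathrm{PGL}_n(\mathbb{F}_{q^s})|}\,\mu(r/s), \] where the sum is over the positive divisors $s$ of $r$ and $\mu$ is the M\''obius function.
   Context: Algebras are associative with identity and subalgebras contain the identity. $\mathbb{F}_q$ is the field with $q$ elements. $\mathrm{g}_m(n,q,r)$ denotes the number of $m$-tuples of elements of the matrix ring $\mathrm{M}_n(\mathbb{F}_{q^r})$ which generate $\mathrm{M}_n(\mathbb{F}_{q^r})$ as an $\mathbb{F}_q$-algebra (i.e. the smallest unital $\mathbb{F}_q$-subalgebra containing them is everything), and $\mathrm{g}_m(n,q)=\mathrm{g}_m(n,q,1)$; thus $\mathrm{g}_m(n,q^s)$ is the number of $m$-tuples generating $\mathrm{M}_n(\mathbb{F}_{q^s})$ as an $\mathbb{F}_{q^s}$-algebra. *)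

(* Defs.v *)
From mathcomp Require Import all_boot all_order all_fingroup all_algebra.
From mathcomp Require Import all_solvable all_field.

Set Implicit Arguments.
Unset Strict Implicit.
Unset Printing Implicit Defensive.

Import GRing.Theory.
Local Open Scope ring_scope.

(* A finite extension L / F is given by a morphism of fields iota : F -> L,    *)
(* through which every L-algebra, such as 'M[L]_n, is an F-algebra.            *)
Definition is_subalgebra (F L : finFieldType) (iota : {rmorphism F -> L}) (n : nat)
    (S : {set 'M[L]_n}) : bool :=
  [&& 1%:M \in S,
      [forall A in S, forall B in S, A + B \in S],
      [forall A in S, forall B in S, A *m B \in S]
    & [forall c : F, forall A in S, iota c *: A \in S]].

Definition generated_subalgebra (F L : finFieldType) (iota : {rmorphism F -> L}) (n : nat)
    (X : {set 'M[L]_n}) : {set 'M[L]_n} :=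
  \bigcap_(S : {set 'M[L]_n} | is_subalgebra iota S && (X \subset S)) S.

Definition generates (F L : finFieldType) (iota : {rmorphism F -> L}) (n : nat)
    (m : nat) (t : m.-tuple 'M[L]_n) : bool :=
  generated_subalgebra iota [set A in t] == [set: 'M[L]_n].

Definition g (F L : finFieldType) (iota : {rmorphism F -> L}) (n : nat)
    (m : nat) : nat :=
  #|[set t : m.-tuple 'M[L]_n | generates iota t]|.

(* #|PGL_n(L)| for 0 < n; {'GL_n[L]} is built on 'M[L]_(n.-1.+1), so that the  *)
(* value at n = 0 is that at n = 1.                                            *)
Definition card_PGL (n : nat) (L : finFieldType) : nat :=
  #|'GL_n[L] / 'Z('GL_n[L])|%g.

(* The value at 0 is irrelevant.                                               *)
Definition mobius (n : nat) : int :=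
  if all (fun p => logn p n == 1%N) (primes n) then (-1) ^+ size (primes n)
  else 0.

(* Main.v *)
Require Import Defs.
From HB Require Import structures.
From mathcomp Require Import all_boot all_order all_fingroup all_algebra.
From mathcomp Require Import all_solvable all_field.
From mathcomp Require Import zify.
Import GRing.Theory Num.Theory.
Local Open Scope ring_scope.

(** By Moebius inversion ([mobius_inversion]) the theorem amounts to the identity
<<
  g(n, L over L) / |PGL_n(L)| = sum_(s | r) g(n, K s over F_q) / |PGL_n(K s)|
>>
for every field [L] of order [q ^ r] ([sum_over_subfields]). Let the tuple [t]
generate ['M_n(L)] over [L], and let [A] be the algebra that it generates over
F_q, a subring whose [L]-linear span is everything. Then [A] is conjugate in
[GL_n(L)] to ['M_n(Z)] for a subfield [Z] of [L] ([spanning_subring_conj]); [Z]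
contains F_q, so it is the subfield of order [q ^ s] for some divisor [s] of [r].
The group [GL_n(L)] acts by conjugation on the tuples for which [Z] has order
[q ^ s], and the normalizer of ['M_n(Z)] consists of the scalar multiples of the elements of
[GL_n(Z)]; hence ['M_n(Z)] has [|PGL_n(L)| / |PGL_n(Z)|] conjugates, and each of
them is generated by [g(n, Z over F_q)] tuples ([card_tuples_PGL]). Summing over
[s] gives the identity.

The structure of [A] is found without any theory of semisimple algebras. An
idempotent [e] of least rank in [A] is primitive, and nondegeneracy of the trace
form forbids nonzero nil right ideals in the corner [e A e], which is therefore a
finite division ring. By Wedderburn's little theorem it is commutative, hence so is its span
[e M_n(L) e], which forces [e] to have rank one: [e = u *m v] with a column [u]
and a row [v]. The subfield [Z] is read off from [e A e = Z *: e], and bases of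
[L^n] made of rows [v *m a] and of columns [b *m u], with [a] and [b] in [A],
give the conjugation.

Everything is stated for sets of scalars and entries inside [L]; the subfields
are then the sets [[set x | x ^+ q == x]] and depend on no embedding. That the
abstract fields [K s] are isomorphic to these subfields is
[finField_embedding]. *)

Set Implicit Arguments.
Unset Strict Implicit.
Unset Printing Implicit Defensive.

(** * Moebius inversion *)

Lemma mobius_mul_prime p d : prime p -> ~~ (p %| d)%N -> (0 < d)%N ->
  mobius (p * d) = - mobius d.
Proof.
move=> p_pr p'd d_gt0; have p_gt0 := prime_gt0 p_pr.
have primes_pd : perm_eq (primes (p * d)) (p :: primes d).
  apply: uniq_perm; rewrite ?primes_uniq //= ?primes_uniq ?andbT.
    by rewrite mem_primes (negPf p'd) !andbF.
  by move=> x; rewrite primesM // primes_prime // !inE.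
rewrite /mobius (perm_all _ primes_pd) (perm_size primes_pd) /=.
rewrite lognM // logn_prime // eqxx lognE (negPf p'd) !andbF /= exprS.
have -> : all (fun x => logn x (p * d) == 1)%N (primes d) =
          all (fun x => logn x d == 1)%N (primes d).
  apply: eq_in_all => x; rewrite mem_primes => /and3P[x_pr _ x_d].
  rewrite lognM // logn_prime //; case: (eqVneq x p) => // xp.
  by rewrite -xp x_d in p'd.
by case: all; rewrite ?mulN1r ?oppr0.
Qed.

Lemma mobius_square p d : prime p -> (0 < d)%N -> (p ^ 2 %| d)%N -> mobius d = 0.
Proof.
move=> p_pr d_gt0; rewrite pfactor_dvdn // => p2d; rewrite /mobius ifF //.
apply/negP => /allP/(_ p); rewrite -logn_gt0 (ltnW p2d) => /(_ isT)/eqP p1.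
by rewrite p1 in p2d.
Qed.

(** For [n > 1] the squarefree divisors of [n] pair off as [d], [p * d], where [p] is a prime
factor of [n] that does not divide [d], and [mobius] takes opposite values on
the two members of a pair. *)
Lemma sum_mobius n : (0 < n)%N -> \sum_(d <- divisors n) mobius d = (n == 1%N)%:R.
Proof.
move=> n_gt0; have [->|n_neq1] := eqVneq n 1%N; first by rewrite big_seq1.
have n_gt1 : (1 < n)%N by case: n n_gt0 n_neq1 => [|[]].
set p := pdiv n; have p_pr : prime p := pdiv_prime n_gt1.
have p_gt0 := prime_gt0 p_pr.
rewrite (bigID (fun d => p %| d)%N) /= (bigID (fun d => p ^ 2 %| d)%N) /=.
rewrite big1_seq ?add0r => [|d]; last first.
  rewrite -dvdn_divisors // => /andP[/andP[_ p2d] dn].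
  by apply: (mobius_square p_pr); rewrite // (dvdn_gt0 n_gt0).
rewrite -big_filter -[X in _ + X]big_filter.
set r1 := filter _ _; set r2 := filter _ _.
have mem2 d : d \in r2 = ~~ (p %| d)%N && (d %| n)%N.
  by rewrite mem_filter -dvdn_divisors.
have r12 : perm_eq r1 [seq (p * d)%N | d <- r2].
  apply: uniq_perm; rewrite ?filter_uniq ?divisors_uniq //.
    rewrite map_inj_uniq ?filter_uniq ?divisors_uniq // => x y /eqP.
    by rewrite eqn_pmul2l // => /eqP.
  move=> d; rewrite mem_filter -dvdn_divisors //; apply/idP/mapP.
    case/andP=> /andP[/dvdnP[c ->] p2d] cpn; exists c; last by rewrite mulnC.
    rewrite mem2 (dvdn_trans (dvdn_mulr p (dvdnn c)) cpn) andbT.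
    by rewrite expnS expn1 dvdn_pmul2r // in p2d.
  case=> c; rewrite mem2 => /andP[p'c cn] ->.
  rewrite dvdn_mulr //= expnS expn1 dvdn_pmul2l // p'c /=.
  by rewrite Gauss_dvd ?pdiv_dvd // prime_coprime.
rewrite (perm_big _ r12) big_map -big_split /= big1_seq // => d /=.
rewrite mem2 => /andP[p'd dn]; rewrite mobius_mul_prime ?addNr //.
exact: (dvdn_gt0 n_gt0).
Qed.

Lemma divn_div_id r d : (d %| r)%N -> (0 < r)%N -> (r %/ (r %/ d) = d)%N.
Proof. by move=> dr r_gt0; rewrite divnA // mulKn. Qed.

(** Substituting [a], the coefficient of [b t] is the sum of [mobius (r %/ s)]
over the [s] with [t %| s] and [s %| r]; as [s] varies, [r %/ s] runs through
the divisors of [r %/ t], so that only [t = r] survives. *)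
Lemma mobius_inversion (R : pzRingType) (a b : nat -> R) r : (0 < r)%N ->
    (forall u, (u %| r)%N -> a u = \sum_(s <- divisors u) b s) ->
  b r = \sum_(s <- divisors r) a s * (mobius (r %/ s))%:~R.
Proof.
move=> r_gt0 aE.
have -> : \sum_(s <- divisors r) a s * (mobius (r %/ s))%:~R =
    \sum_(s <- divisors r) \sum_(t <- divisors r | (t %| s)%N)
       b t * (mobius (r %/ s))%:~R.
  apply: eq_big_seq => s; rewrite -dvdn_divisors // => sr.
  rewrite aE // mulr_suml -[RHS]big_filter; apply: perm_big.
  apply: uniq_perm; rewrite ?filter_uniq ?divisors_uniq // => t.
  rewrite mem_filter -!dvdn_divisors ?(dvdn_gt0 r_gt0) //.
  by case: (boolP (t %| s)%N) => // ts; rewrite (dvdn_trans ts).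
rewrite (exchange_big_dep predT) //=.
have inner t : (t %| r)%N ->
    \sum_(s <- divisors r | (t %| s)%N) b t * (mobius (r %/ s))%:~R =
    b t * (t == r)%:R.
  move=> tr; have t_gt0 := dvdn_gt0 r_gt0 tr.
  have rt_gt0 : (0 < r %/ t)%N by rewrite divn_gt0 // dvdn_leq.
  have -> : (t == r)%:R = (((r %/ t)%N == 1%N)%:R : int)%:~R :> R.
    by rewrite -[(r %/ t == 1)%N](eqn_pmul2r t_gt0) divnK // mul1n eq_sym; case: eqP.
  rewrite -mulr_sumr -sum_mobius // rmorph_sum /= -big_filter; congr (_ * _).
  have quotients : perm_eq (divisors (r %/ t))
      [seq (r %/ s)%N | s <- [seq s <- divisors r | (t %| s)%N]].
    apply: uniq_perm; rewrite ?divisors_uniq //.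
      rewrite map_inj_in_uniq ?filter_uniq ?divisors_uniq // => x y.
      rewrite !mem_filter -!dvdn_divisors // => /andP[_ xr] /andP[_ yr] xy.
      by rewrite -(divn_div_id xr) // xy divn_div_id.
    move=> d; rewrite -dvdn_divisors //; apply/idP/mapP => [|[s]].
      rewrite dvdn_divRL // => dtr; have dr := dvdn_trans (dvdn_mulr t (dvdnn d)) dtr.
      exists (r %/ d)%N; last by rewrite divn_div_id.
      by rewrite mem_filter -dvdn_divisors // dvdn_divRL // mulnC dtr dvdn_div.
    rewrite mem_filter -dvdn_divisors // => /andP[ts sr] ->.
    by rewrite dvdn_divRL // -[X in (_ %| X)%N](divnK sr) dvdn_mul.
  by rewrite (perm_big _ quotients) big_map.
rewrite (eq_big_seq (fun t => b t * (t == r)%:R)); last first.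
  by move=> t; rewrite -dvdn_divisors //; apply: inner.
rewrite (bigD1_seq r) ?divisors_uniq ?divisors_id //= eqxx mulr1 big1 ?addr0 //.
by move=> t /negPf->; rewrite mulr0.
Qed.

(** * Finite rings *)

Section Corner.
Variables (R : finNzRingType) (A : {set R}) (e : R).
Hypotheses (A_e : e \in A) (e_nz : e != 0).
Hypothesis AB : {in A &, forall x y, x - y \in A}.
Hypothesis AM : {in A &, forall x y, x * y \in A}.
Hypothesis eA : {in A, forall x, e * x = x}.
Hypothesis Ae : {in A, forall x, x * e = x}.

Definition corner := {x : R | x \in A}.
HB.instance Definition _ := Finite.on corner.
Let c0 : corner := Sub (e - e) (AB A_e A_e).
Let AN x : x \in A -> - x \in A.
Proof. by move=> Ax; have := AB (AB Ax Ax) Ax; rewrite subrr sub0r. Qed.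
Let AD x y : x \in A -> y \in A -> x + y \in A.
Proof. by move=> Ax Ay; rewrite -(opprK y); apply/AB/AN. Qed.
Let cN (x : corner) : corner := Sub (- val x) (AN (valP x)).
Let cD (x y : corner) : corner := Sub (val x + val y) (AD (valP x) (valP y)).
Let cM (x y : corner) : corner := Sub (val x * val y) (AM (valP x) (valP y)).
Let c1 : corner := Sub e A_e.
Let cDA : associative cD. Proof. by move=> x y z; apply/val_inj/addrA. Qed.
Let cDC : commutative cD. Proof. by move=> x y; apply/val_inj/addrC. Qed.
Let c0D : left_id c0 cD.
Proof. by move=> x; apply/val_inj; rewrite /= subrr add0r. Qed.
Let cND : left_inverse c0 cN cD.
Proof. by move=> x; apply/val_inj; rewrite /= subrr addNr. Qed.
HB.instance Definition _ := GRing.isZmodule.Build corner cDA cDC c0D cND.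
Let cMA : associative cM. Proof. by move=> x y z; apply/val_inj/mulrA. Qed.
Let c1M : left_id c1 cM. Proof. by move=> x; apply/val_inj/eA/valP. Qed.
Let cM1 : right_id c1 cM. Proof. by move=> x; apply/val_inj/Ae/valP. Qed.
Let cMDl : left_distributive cM cD.
Proof. by move=> x y z; apply/val_inj/mulrDl. Qed.
Let cMDr : right_distributive cM cD.
Proof. by move=> x y z; apply/val_inj/mulrDr. Qed.
Let c1_nz : c1 != 0. Proof. by rewrite -val_eqE /= subrr. Qed.
HB.instance Definition _ :=
  GRing.Zmodule_isNzRing.Build corner cMA c1M cM1 cMDl cMDr c1_nz.
HB.instance Definition _ := FinRing.isNzRing.Build corner.

(** Wedderburn's little theorem, for a subset closed under the ring operations
whose identity [e] need not be that of the ambient ring: this is the case of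
the corner [e A e] of a matrix ring. *)
Lemma corner_domain_comm :
  {in A &, forall x y, x * y = 0 -> x = 0 \/ y = 0} -> {in A &, commutative *%R}.
Proof.
move=> domA x y Ax Ay.
have dom : GRing.integral_domain_axiom (corner : finUnitRingType).
  move=> u v /(congr1 val) /=; rewrite subrr => /domA.
  by rewrite -!val_eqE /= subrr => /(_ (valP u) (valP v)) [] ->; rewrite eqxx ?orbT.
exact: (congr1 val (finDomain_mulrC dom (Sub x Ax) (Sub y Ay))).
Qed.
End Corner.

(** The powers of [x] are eventually periodic; an exponent that is a multiple of
the period and lies beyond the preperiod gives an idempotent. *)
Lemma idempotent_expr (R : finNzRingType) (x : R) :
  exists k, x ^+ k.+1 * x ^+ k.+1 = x ^+ k.+1.
Proof.
have [i [d xid]] : exists i d, x ^+ i = x ^+ (i + d.+1).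
  have /injectivePn[i [j neq_ij eq_ij]] :
      ~~ injectiveb (fun i : 'I_#|R|.+1 => x ^+ i).
    apply/negP => /injectiveP/leq_card; rewrite card_ord.
    by rewrite ltnn.
  wlog lt_ij : i j neq_ij eq_ij / (i < j)%N.
    move=> IH; have [|lt_ji|/val_inj eqij] := ltngtP i j; first exact: IH.
      by apply: (IH j i) => //; rewrite eq_sym.
    by rewrite eqij eqxx in neq_ij.
  by exists i, (j - i.+1)%N; rewrite addnS -addSn subnKC.
have shift k c : x ^+ (i + k) = x ^+ (i + k + c * d.+1).
  elim: c => [|c IHc]; first by rewrite addn0.
  rewrite IHc (_ : i + k + c.+1 * _ = (i + d.+1) + (k + c * d.+1))%N; last by lia.
  by rewrite [RHS]exprD -xid -exprD addnA.
exists (i * d.+1 + d)%N; rewrite -exprD.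
rewrite (_ : (i * d.+1 + d).+1 = i + (i * d + d.+1))%N; last by lia.
rewrite [RHS](shift _ i.+1); congr (x ^+ _); lia.
Qed.

Lemma exprS_mulmxC (R : pzRingType) m n (u : 'M[R]_(m, n)) (v : 'M_(n, m)) k :
  (v *m u) ^+ k.+1 = v *m (u *m v) ^+ k *m u.
Proof.
elim: k => [|k IHk]; first by rewrite expr0 expr1 mulmx1.
by rewrite exprS IHk [in RHS]exprS -!mulmxE !mulmxA.
Qed.

(** A nilpotent [z] factors as [z = u *m v] through a space of dimension [\rank z],
smaller than [n]. There [v *m u] is again nilpotent and has the same trace,
which allows induction on the size. *)
Lemma mxtrace_nilpotent (F : fieldType) n (z : 'M[F]_n) k :
  z ^+ k = 0 -> \tr z = 0.
Proof.
elim/ltn_ind: n z k => -[|n] IHn z k zk0; first by rewrite /mxtrace big_ord0.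
have ltrn : (\rank z < n.+1)%N.
  rewrite ltn_neqAle rank_leq_row andbT; apply/negP => zfull.
  have zu : z \is a GRing.unit by rewrite unitmxE -unitmxE -row_full_unit.
  by have := unitrX k zu; rewrite zk0 unitr0.
rewrite -[z]mulmx_base mxtrace_mulC (IHn _ ltrn _ k.+1) //.
by rewrite exprS_mulmxC mulmx_base zk0 mulmx0 mul0mx.
Qed.

(** Closure under the opposite is automatic: in a finite ring [- x] is a multiple
[x *+ k] with [k > 0]. *)
Definition subring_set (R : finNzRingType) (S : {set R}) : Prop :=
  [/\ 1 \in S, {in S &, forall x y, x + y \in S}
    & {in S &, forall x y, x * y \in S}].

Section SubringSet.
Variables (R : finNzRingType) (S : {set R}).
Hypothesis subS : subring_set S.

Lemma subring_setN : {in S, forall x, - x \in S}.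
Proof.
have [S1 SD SM] := subS => x Sx.
have Smul k : x *+ k.+1 \in S.
  by elim: k => [|k IHk]; [rewrite mulr1n | rewrite mulrS SD].
have x_card : x *+ #|[set: R]| = 0.
  by have := expg_cardG (in_setT x); rewrite FinRing.zmodXgE.
have : (1 < #|[set: R]|)%N by rewrite cardsT finNzRing_gt1.
case: #|_| x_card => [|[|k]] // x_card _.
suff -> : - x = x *+ k.+1 by exact: Smul.
by apply/eqP; rewrite eq_sym -addr_eq0 -mulrSr x_card.
Qed.

Lemma subring_setB : {in S &, forall x y, x - y \in S}.
Proof. by have [_ SD _] := subS => x y Sx Sy; rewrite SD // subring_setN. Qed.

Lemma subring_set0 : 0 \in S.
Proof. by have [S1 _ _] := subS; rewrite -(subrr 1) subring_setB. Qed.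

Lemma subring_setX k : {in S, forall x, x ^+ k \in S}.
Proof.
have [S1 _ SM] := subS => x Sx.
by elim: k => [|k IHk]; rewrite ?expr0 // exprS SM.
Qed.

Lemma subring_set_sum I (r : seq I) (F : I -> R) :
  (forall i, F i \in S) -> \sum_(i <- r) F i \in S.
Proof.
have [_ SD _] := subS => SF.
by elim/big_ind: _ => //; apply: subring_set0.
Qed.

End SubringSet.

Lemma subring_setV (R : finUnitRingType) (S : {set R}) :
  subring_set S -> {in S, forall x, x \is a GRing.unit -> x^-1 \in S}.
Proof.
move=> subS x Sx Ux; pose u := FinRing.unit R Ux.
have -> : x^-1 = x ^+ #[u]%g.-1.
  apply: (mulrI Ux); rewrite divrr // -exprS prednK ?order_gt0 //.
  by rewrite -[x]/(val u) -FinRing.val_unitX expg_order.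
exact: subring_setX.
Qed.

(** * Subfields of a finite field *)

(** Euclidean division of exponents: [p ^ b - 1] is congruent to
[p ^ (b - a) - 1] modulo [p ^ a - 1]. *)
Lemma dvdn_pred_exp p a b : (1 < p)%N ->
  ((p ^ a).-1 %| (p ^ b).-1)%N -> (a %| b)%N.
Proof.
move=> p_gt1; have p_gt0 : (0 < p)%N by apply: ltnW.
elim/ltn_ind: b => b IHb dvd_ab; have [lt_ba|le_ab] := ltnP b a.
  have /eqP : (p ^ b).-1 = 0%N.
    apply/eqP; apply: contraTT dvd_ab; rewrite -lt0n => /gtnNdvd-> //.
    have := expn_gt0 p b; have := ltn_exp2l b a p_gt1; rewrite lt_ba p_gt0 /=.
    by lia.
  have := ltn_exp2l 0 b p_gt1; rewrite expn0.
  by case: b {IHb dvd_ab lt_ba} => // b; lia.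
case: (posnP a) => [a0|a_gt0].
  move: dvd_ab; rewrite a0 expn0 dvd0n; have := ltn_exp2l 0 b p_gt1; rewrite expn0.
  by case: b {IHb le_ab} => // b; lia.
have -> : b = (a + (b - a))%N by rewrite subnKC.
rewrite dvdn_addr ?dvdnn //; apply: IHb; first by lia.
rewrite -(dvdn_addr _ (dvdn_mulr (p ^ (b - a)) (dvdnn (p ^ a).-1))).
have pE : (p ^ b = p ^ a * p ^ (b - a))%N by rewrite -expnD subnKC.
suff <- : (p ^ b).-1 = ((p ^ a).-1 * p ^ (b - a) + (p ^ (b - a)).-1)%N by [].
have : (0 < p ^ a)%N by rewrite expn_gt0 p_gt0.
have : (0 < p ^ (b - a))%N by rewrite expn_gt0 p_gt0.
rewrite pE; case: (p ^ a)%N => // x; case: (p ^ (b - a))%N => // y _ _.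
by rewrite /= mulnS; lia.
Qed.

Section FiniteSubfields.
Variables (L : finFieldType).
Implicit Types Z : {set L}.

Definition unit_part Z := [set u : {unit L} | FinRing.uval u \in Z].

Lemma group_set_unit_part Z : subring_set Z -> group_set (unit_part Z).
Proof.
case=> Z1 _ ZM; apply/group_setP; split=> [|u v]; rewrite !inE //.
exact: ZM.
Qed.

Lemma card_unit_part Z : 0 \in Z -> #|unit_part Z| = #|Z|.-1.
Proof.
move=> Z0; rewrite (cardsD1 0 Z) Z0 -(card_imset _ (@val_inj _ _ {unit L})) /=.
apply: eq_card => x; rewrite !inE; apply/imsetP/andP => [[u]|[x_nz Zx]].
  by rewrite inE => Zu ->; rewrite -unitfE (valP u).
by exists (finField_unit x_nz); rewrite ?inE.
Qed.

Lemma dvdn_subring_card_pred Z1 Z2 : subring_set Z1 -> subring_set Z2 ->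
  Z1 \subset Z2 -> (#|Z1|.-1 %| #|Z2|.-1)%N.
Proof.
move=> sub1 sub2 s12; rewrite -!card_unit_part ?subring_set0 //.
apply: (@cardSg _ (group (group_set_unit_part sub2))
  (group (group_set_unit_part sub1))).
by apply/subsetP=> u; rewrite !inE; apply: (subsetP s12).
Qed.

(** The nonzero elements of [Z] form a group of order [#|Z| - 1], so that [Z]
consists of roots of ['X^#|Z| - 'X], and this polynomial has no more than
[#|Z|] roots. Hence a subfield of a finite field is determined by its order. *)
Lemma subring_eq_fixed Z : subring_set Z -> Z = [set x | x ^+ #|Z| == x].
Proof.
move=> subZ; have Z0 := subring_set0 subZ; have [Z1 _ _] := subZ.
have card_gt1 : (1 < #|Z|)%N.
  by apply/card_gt1P; exists 0, 1; rewrite eq_sym oner_eq0.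
apply/eqP; rewrite eqEcard; apply/andP; split.
  apply/subsetP=> x Zx; rewrite inE; have [->|x_nz] := eqVneq x 0.
    by rewrite expr0n gtn_eqF ?eqxx // ltnW.
  have Gu : finField_unit x_nz \in group (group_set_unit_part subZ) by rewrite inE.
  have /(congr1 val) := expg_cardG Gu.
  rewrite FinRing.val_unitX /= card_unit_part // => xk.
  by rewrite -(prednK (ltnW card_gt1)) exprS xk mulr1.
set S := [set _ | _]; pose P : {poly L} := 'X^#|Z| - 'X.
have sizeP : size P = #|Z|.+1.
  by rewrite size_polyDl size_polyXn // size_polyN size_polyX ltnS.
rewrite -ltnS -sizeP cardE max_poly_roots ?enum_uniq -?size_poly_gt0 ?sizeP //.
apply/allP=> x; rewrite mem_enum inE rootE !hornerE subr_eq0.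
exact.
Qed.

Lemma subring_card_exp Z p k : prime p -> #|L| = (p ^ k)%N -> subring_set Z ->
  exists a, #|Z| = (p ^ a)%N.
Proof.
move=> p_pr cardL subZ; have [_ ZD _] := subZ.
have gZ : group_set Z.
  by apply/group_setP; split=> [|x y]; [apply: subring_set0 | apply: ZD].
have : (#|group gZ| %| p ^ k)%N by rewrite -cardL -cardsT cardSg ?subsetT.
by case/(dvdn_pfactor _ _ p_pr) => a _ ->; exists a.
Qed.

(** All the fields involved have order a power of [p]; inclusions of their
multiplicative groups give divisibilities between the numbers [p ^ a - 1],
hence between the exponents [a]. *)
Lemma card_subring_over Z p e q r : prime p -> (0 < e)%N -> q = (p ^ e)%N ->
    #|L| = (q ^ r)%N -> subring_set Z ->
    subring_set [set x : L | x ^+ q == x] -> #|[set x : L | x ^+ q == x]| = q ->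
    [set x : L | x ^+ q == x] \subset Z ->
  exists2 s, (s %| r)%N & #|Z| = (q ^ s)%N.
Proof.
move=> p_pr e_gt0 -> cardL subZ subC cardC sCZ; rewrite -expnM in cardL.
have [a cardZ] := subring_card_exp p_pr cardL subZ.
have p_gt1 := prime_gt1 p_pr.
have /(dvdn_pred_exp p_gt1)/dvdnP[s def_a] : ((p ^ e).-1 %| (p ^ a).-1)%N.
  by rewrite -cardZ -[X in (X.-1 %| _)%N]cardC dvdn_subring_card_pred.
have subT : subring_set [set: L] by split=> [|x y _ _|x y _ _]; rewrite inE.
exists s; last by rewrite cardZ def_a mulnC expnM.
rewrite -(dvdn_pmul2r e_gt0) -def_a mulnC; apply: (dvdn_pred_exp p_gt1).
by rewrite -cardZ -cardL -cardsT dvdn_subring_card_pred ?subsetT.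
Qed.

Lemma subring_imset (E : finFieldType) (i : {rmorphism E -> L}) :
  subring_set (i @: setT).
Proof.
split=> [|x y|x y].
- by apply/imsetP; exists 1; rewrite ?rmorph1.
- by move=> /imsetP[a _ ->] /imsetP[b _ ->]; rewrite -rmorphD imset_f.
- by move=> /imsetP[a _ ->] /imsetP[b _ ->]; rewrite -rmorphM imset_f.
Qed.

Lemma imset_rmorph_fixed (E : finFieldType) (i : {rmorphism E -> L}) :
  i @: setT = [set x | x ^+ #|E| == x].
Proof.
have := subring_eq_fixed (subring_imset i).
by rewrite card_imset ?cardsT //; apply: fmorph_inj.
Qed.

End FiniteSubfields.

(** The multiplicative group of [E] is generated by some [u]. The minimal
polynomial of [u] over the prime field divides ['X^#|L| - 'X], because
[u ^+ #|L| = u]; it therefore has a root [b] in [L], and [u] can be sent to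
[b]. *)
Lemma finField_embedding (E L : finFieldType) k : #|L| = (#|E| ^ k)%N ->
  exists i : {rmorphism E -> L}, True.
Proof.
move=> cardL; have [p p_pr chE] := finPcharP E.
have chL : p \in [pchar L].
  have := card_pprimeChar chE; move: (logn _ _) => c cardE.
  by apply: (card_finPcharP (n := c * k)); rewrite ?cardL ?expnM -?cardE.
pose fE : {rmorphism 'F_p -> pPrimeCharType chE} := GRing.in_alg _.
pose fL : {rmorphism 'F_p -> pPrimeCharType chL} := GRing.in_alg _.
move: (fE : {rmorphism 'F_p -> E}) (fL : {rmorphism 'F_p -> L}) => {}fE {}fL.
have [u genu] : exists u : E, forall x, x != 0 -> exists j, x = u ^+ j.
  have /cyclicP[u def_u] := field_unit_group_cyclic [set: {unit E}]%G.
  exists (val u) => x x_nz.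
  have : finField_unit x_nz \in <[u]>%g by rewrite -def_u inE.
  case/cycleP=> j /(congr1 val); rewrite FinRing.val_unitX /= => ->.
  by exists j.
pose van (P : {poly 'F_p}) := (map_poly fE P).[u] == 0.
pose X := 'X^#|L| - 'X : {poly 'F_p}.
have expu (x : E) : x ^+ #|L| = x.
  rewrite cardL; elim: k {cardL} => [|k IHk]; rewrite ?expr1 //.
  by rewrite expnS exprM expf_card.
have vanX : van X.
  by rewrite /van rmorphB /= map_polyXn map_polyX !hornerE expu subrr.
have X_nz : X != 0.
  rewrite -size_poly_gt0 size_polyDl size_polyXn // size_polyN size_polyX.
  by rewrite ltnS finNzRing_gt1.
(* m is the minimal polynomial of u over the prime field. *)
have [m [m_nz van_m min_m]] : exists m : {poly 'F_p}, [/\ m != 0, van m &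
    forall P, van P -> (size P < size m)%N -> P = 0].
  pose ok (v : 'rV['F_p]_(#|L|.+1)) := (rVpoly v != 0) && van (rVpoly v).
  have sX : (size X <= #|L|.+1)%N.
    by rewrite size_polyDl size_polyXn // size_polyN size_polyX ltnS finNzRing_gt1.
  have okX : ok (poly_rV X) by rewrite /ok poly_rV_K ?X_nz.
  case: (arg_minnP (fun v => size (rVpoly v)) okX) => v /andP[v_nz van_v] min_v.
  exists (rVpoly v); split=> // P vanP ltP; apply/eqP; apply: contraTT ltP => P_nz.
  have [sP|/ltnW ltP] := leqP (size P) #|L|.+1; rewrite -leqNgt.
    by rewrite -(poly_rV_K sP) min_v // /ok poly_rV_K ?P_nz.
  by apply: leq_trans ltP; rewrite size_poly.
have vanE P : van P = (m %| P).
  apply/idP/idP => [vanP|/dvdpP[c ->]]; last first.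
    by rewrite /van rmorphM hornerM (eqP van_m) mulr0.
  rewrite /dvdp; apply/eqP; apply: min_m; last by rewrite ltn_modp.
  have -> : P %% m = P - P %/ m * m by rewrite {2}(divp_eq P m) addrC addKr.
  by rewrite /van rmorphB rmorphM !hornerE (eqP vanP) (eqP van_m) mulr0 subr0.
(* m divides X^#|L| - X, which splits in L. *)
have [b bm] : exists b, root (map_poly fL m) b.
  have : map_poly fL m %| \prod_x ('X - x%:P).
    rewrite -finField_genPoly (_ : _ - _ = map_poly fL X).
      by rewrite dvdp_map -vanE.
    by rewrite rmorphB /= map_polyXn map_polyX.
  case/dvdp_prod_XsubC => msk; case: (mask _ _) => [|b r] eq_m.
    have /size_poly1P[c c_nz def_m] : size m == 1%N.
      by rewrite -(size_map_poly fL) (eqp_size eq_m) big_nil size_poly1.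
    by move: van_m; rewrite /van def_m map_polyC hornerC fmorph_eq0 (negPf c_nz).
  by exists b; rewrite (eqp_root eq_m) root_prod_XsubC mem_head.
have vanL P : van P -> (map_poly fL P).[b] = 0.
  by rewrite vanE => /dvdpP[c ->]; rewrite rmorphM hornerM (rootP bm) mulr0.
have ex x : exists P : {poly 'F_p}, (map_poly fE P).[u] == x.
  have [->|/genu[j ->]] := eqVneq x 0; first by exists 0; rewrite rmorph0 horner0.
  by exists 'X^j; rewrite map_polyXn hornerXn.
(* i (P(u)) = P(b) for every P over the prime field. *)
pose i x := (map_poly fL (xchoose (ex x))).[b].
have iE P : i (map_poly fE P).[u] = (map_poly fL P).[b].
  apply/eqP; rewrite -subr_eq0 -hornerN -hornerD -rmorphB /=; apply/eqP/vanL.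
  by rewrite /van rmorphB hornerD hornerN (eqP (xchooseP (ex _))) subrr.
have iB : zmod_morphism i.
  move=> x y; have [/eqP <- /eqP <-] := (xchooseP (ex x), xchooseP (ex y)).
  by rewrite -hornerN -hornerD -rmorphB !iE rmorphB hornerD hornerN.
have iM : monoid_morphism i.
  split=> [|x y].
    by rewrite -(hornerC 1 u) polyC1 -(rmorph1 (map_poly fE)) iE rmorph1 hornerC.
  have [/eqP <- /eqP <-] := (xchooseP (ex x), xchooseP (ex y)).
  by rewrite -hornerM -rmorphM !iE rmorphM hornerM.
pose iA := GRing.isZmodMorphism.Build _ _ i iB.
pose iR := GRing.isMonoidMorphism.Build _ _ i iM.
by exists (HB.pack_for {rmorphism E -> L} i iA iR).
Qed.

(** * Spanning subrings of a matrix algebra *)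

Definition mxset (L : finFieldType) n (Z : {set L}) : {set 'M[L]_n} :=
  [set X : 'M[L]_n | [forall i, forall j, X i j \in Z]].

Lemma mxsetP (L : finFieldType) n (Z : {set L}) (X : 'M[L]_n) :
  reflect (forall i j, X i j \in Z) (X \in mxset n Z).
Proof. by rewrite inE; apply: (iffP 'forall_forallP). Qed.

Lemma subring_mxset (L : finFieldType) n (Z : {set L}) :
  subring_set Z -> subring_set (mxset n.+1 Z).
Proof.
move=> subZ; have [Z1 ZD ZM] := subZ; split.
- by apply/mxsetP=> i j; rewrite mxE; case: eqP; rewrite // subring_set0.
- move=> X Y /mxsetP ZX /mxsetP ZY; apply/mxsetP=> i j.
  by rewrite mxE ZD.
move=> X Y /mxsetP ZX /mxsetP ZY; apply/mxsetP=> i j.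
by rewrite mxE subring_set_sum // => k; rewrite ZM.
Qed.

Lemma mul_col_rowE (R : pzSemiRingType) m n p q (B : 'M[R]_(m, n)) (C : 'M[R]_(p, q))
    j i k l :
  (col j B *m row i C) k l = B k j * C i l.
Proof. by rewrite mxE big_ord1 !mxE. Qed.

Lemma mulmx_delta_mulmx (R : pzSemiRingType) m n p q (B : 'M[R]_(m, n))
    (C : 'M[R]_(p, q)) i j :
  B *m delta_mx i j *m C = col i B *m row j C.
Proof. by rewrite colE rowE -(mul_delta_mx (0 : 'I_1)) !mulmxA. Qed.

Section Structure.
Variables (L : finFieldType) (n : nat).
Local Notation M := 'M[L]_n.+1.

(** The linear span of [A] over [L] is everything. Stating this by closure gives
the induction principle [span_ind] at once. *)
Definition spans (A : {set M}) : Prop :=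
  forall S : {set M}, A \subset S -> {in S &, forall x y, x + y \in S} ->
    (forall c, {in S, forall x, c *: x \in S}) -> S = setT.

Variable A : {set M}.
Hypotheses (subA : subring_set A) (spanA : spans A).

Lemma span_ind (P : pred M) :
  {in A, forall x, P x} -> (forall x y, P x -> P y -> P (x + y)) ->
  (forall c x, P x -> P (c *: x)) -> forall x, P x.
Proof.
move=> PA PD PZ x.
have PT : [set y | P y] = setT; last by have := in_setT x; rewrite -PT inE.
apply: spanA.
- by apply/subsetP=> y; rewrite inE; apply: PA.
- by move=> y z; rewrite !inE; apply: PD.
- by move=> c y; rewrite !inE; apply: PZ.
Qed.

Definition primitive_idempotent (e : M) : Prop :=
  [/\ e \in A, e != 0, e * e = e
   & {in A, forall f, e * f = f -> f * e = f -> f * f = f -> f = 0 \/ f = e}].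

(** A nonzero idempotent of [A] of least rank is primitive: an idempotent [f] of
the corner of [e] with the rank of [e] has the row space of [e], whence
[e * f = e]. *)
Lemma primitive_idempotent_exists : exists e : M, primitive_idempotent e.
Proof.
have [A1 AD AM] := subA.
pose I := [pred f : M | [&& f \in A, f != 0 & f * f == f]].
have I1 : I 1 by rewrite /= A1 oner_eq0 mulr1 eqxx.
case: (arg_minnP (fun f : M => \rank f) I1) => e /and3P[Ae e_nz /eqP ee] e_min.
exists e; split=> // f Af ef fe ff.
have [->|f_nz] := eqVneq f 0; [by left | right].
have le_ef : (\rank e <= \rank f)%N by apply: e_min; rewrite /= Af f_nz ff eqxx.
have sub_fe : (f <= e)%MS by apply/submxP; exists f; rewrite -mulmxE in fe *.
have /submxP[D eD] : (e <= f)%MS.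
  by rewrite -(mxrank_leqif_sup sub_fe) eqn_leq le_ef mxrankS.
by rewrite -ef {1}eD mulmxE -mulrA ff -mulmxE -eD.
Qed.

(** If [x] had no right inverse in the corner [e A e], then for every [y] in [A]
the idempotent power of [x * (y * e)] would be different from [e], hence [0];
so [x * (y * e)] would be nilpotent and [\tr (x * y)] would vanish. By
linearity this would hold for all matrices [y], and the trace form is
nondegenerate. *)
Lemma corner_right_inverse (e x : M) :
  primitive_idempotent e -> x \in A -> e * x = x -> x * e = x -> x != 0 ->
  exists2 y, y \in A & x * y = e.
Proof.
have [A1 AD AM] := subA.
move=> [Ae e_nz ee e_min] Ax ex xe x_nz.
have [/exists_inP[y Ay /eqP xy]|/exists_inPn no_inv] :=
  boolP [exists y in A, x * y == e]; first by exists y.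
have tr0 (y : M) : \tr (x * y) == 0.
  apply: (span_ind (P := fun y => \tr (x * y) == 0)) y.
  - move=> y Ay; pose z := x * (y * e).
    have [k zk] := idempotent_expr z.
    have Az : z \in A by rewrite !AM.
    have ez : e * z = z by rewrite /z mulrA ex.
    have ze : z * e = z by rewrite /z -!mulrA ee.
    case: (e_min (z ^+ k.+1)) => //.
    + exact: subring_setX.
    + by rewrite exprS mulrA ez.
    + by rewrite exprSr -mulrA ze.
    + move/mxtrace_nilpotent => <-; apply/eqP.
      by rewrite /z mulrA -[RHS]mxtrace_mulC mulmxE mulrA ex.
    + move=> zk_e; have := no_inv (y * e * z ^+ k).
      rewrite mulrA -/z -exprS zk_e eqxx => no.
      have: ~~ true by apply: no; rewrite !AM ?subring_setX.
      by [].
  - by move=> u v /eqP u0 /eqP v0; rewrite mulrDr mxtraceD u0 v0 addr0.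
  - by move=> c u /eqP u0; rewrite -scalerAr mxtraceZ u0 mulr0.
case/negP: x_nz; apply/eqP/matrixP=> i j; rewrite [RHS]mxE.
have /eqP := tr0 (delta_mx j i); rewrite -mulmxE -(mul_delta_mx (0 : 'I_1)).
rewrite mulmxA mxtrace_mulC -colE -rowE /mxtrace big_ord1 !mxE.
exact.
Qed.

(** The corner [e A e] is a finite division ring, hence commutative, and
commutativity passes to the linear span [e M e]. *)
Lemma corner_comm (e : M) :
  primitive_idempotent e ->
  forall x y : M, (e * x * e) * (e * y * e) = (e * y * e) * (e * x * e).
Proof.
have [A1 AD AM] := subA.
move=> prim_e; have [Ae e_nz ee e_min] := prim_e.
pose B := [set x in A | (e * x == x) && (x * e == x)].
have BP x : reflect [/\ x \in A, e * x = x & x * e = x] (x \in B).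
  by rewrite inE; apply: (iffP and3P) => [[? /eqP ? /eqP ?]|[? -> ->]].
have comB : {in B &, commutative *%R}.
  apply: (@corner_domain_comm _ B e) => //.
  - by apply/BP.
  - move=> x y /BP[Ax ex xe] /BP[Ay ey ye]; apply/BP.
    by rewrite mulrBr mulrBl ex ey xe ye subring_setB.
  - move=> x y /BP[Ax ex xe] /BP[Ay ey ye]; apply/BP.
    by rewrite AM // mulrA ex -mulrA ye.
  - by move=> x /BP[].
  - by move=> x /BP[].
  move=> x y /BP[Ax ex xe] /BP[Ay ey ye] xy0.
  have [->|y_nz] := eqVneq y 0; [by right | left].
  have [y' Ay' yy'] := corner_right_inverse prim_e Ay ey ye y_nz.
  by rewrite -xe -yy' mulrA xy0 mul0r.
have Be x : x \in A -> e * x * e \in B.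
  by move=> Ax; apply/BP; rewrite !AM // !mulrA ee -!mulrA ee.
have comA : {in A, forall x (y : M),
    (e * x * e) * (e * y * e) == (e * y * e) * (e * x * e)}.
  move=> x Ax; apply: span_ind => [y Ay|u v /eqP eu /eqP ev|c u /eqP eu].
  - by rewrite comB ?Be.
  - by rewrite mulrDr !mulrDl mulrDr eu ev.
  - by rewrite -!scalerAr -!scalerAl -scalerAr eu.
move=> x y; apply/eqP; move: x.
apply: span_ind => [x Ax|u v /eqP eu /eqP ev|c u /eqP eu].
- exact: comA.
- by rewrite mulrDr !mulrDl mulrDr eu ev.
- by rewrite -!scalerAr -!scalerAl -scalerAr eu.
Qed.

(** [e M e] is isomorphic to the ring of matrices of size [\rank e], which is
commutative only if [e] has rank one. *)
Lemma idempotent_rank1 (e : M) :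
  e != 0 -> e * e = e ->
  (forall x y : M, (e * x * e) * (e * y * e) = (e * y * e) * (e * x * e)) ->
  exists u : 'cV[L]_n.+1, exists v : 'rV[L]_n.+1, e = u *m v /\ v *m u = 1%:M.
Proof.
move=> e_nz ee com.
(* Commuting e E_ki e with e E_jk e and summing over k gives
   e_ij e = (tr e) col_j(e) row_i(e). *)
have [i [j eij]] : exists i, exists j, e i j != 0.
  case: (pickP (fun ij => e ij.1 ij.2 != 0)) => [[i j] eij | e0].
    by exists i, j.
  case/eqP: e_nz; apply/matrixP=> i j; rewrite mxE; apply/eqP/negbFE.
  exact: (e0 (i, j)).
have ede k l : e * delta_mx k l * e = col k e *m row l e.
  by rewrite -!mulmxE mulmx_delta_mulmx.
have rc k l : row k e *m col l e = (e k l)%:M.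
  by rewrite rowE colE mulmxA -(mulmxA _ e e) mulmxE ee -rowE -colE
    [LHS]mx11_scalar !mxE.
have eded k1 l1 k2 l2 : (e * delta_mx k1 l1 * e) * (e * delta_mx k2 l2 * e) =
    e l1 k2 *: (col k1 e *m row l2 e).
  by rewrite !ede -mulmxE mulmxA -(mulmxA (col _ _)) rc mul_mx_scalar -scalemxAl.
have eab a b k : e i j * (e a k * e k b) = e k k * (e a j * e i b).
  have := com (delta_mx k i) (delta_mx j k).
  by rewrite !eded => /matrixP/(_ a b); rewrite !(mul_col_rowE, mxE).
exists ((\tr e / e i j) *: col j e), (row i e).
have def_e : e = (\tr e / e i j) *: col j e *m row i e.
  apply/matrixP=> a b; apply: (mulfI eij).
  rewrite -scalemxAl [in RHS]mxE mul_col_rowE [RHS]mulrA.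
  rewrite [e i j * (_ / _)]mulrC divfK //.
  have -> : e a b = \sum_k e a k * e k b by rewrite -[in LHS]ee mxE.
  rewrite mulr_sumr (eq_bigr _ (fun k _ => eab a b k)).
  by rewrite -mulr_suml.
split=> //; set c := _ *: _ in def_e *.
have [s rs] : exists s, row i e *m c = s%:M by eexists; apply: mx11_scalar.
rewrite rs; congr (_%:M); apply/eqP; rewrite -subr_eq0.
have : (s - 1) *: e = 0.
  rewrite scalerBl scale1r -{2}ee {2 3}def_e -mulmxE mulmxA -(mulmxA c).
  by rewrite rs mul_mx_scalar -scalemxAl -def_e subrr.
by move/eqP; rewrite scaler_eq0 (negPf e_nz) orbF.
Qed.

End Structure.

(** The conjugate [P^-1 M_n(Z) P] of the matrices with entries in [Z]. *)
Definition conj_mxset (L : finFieldType) n (Z : {set L}) (P : {unit 'M[L]_n.+1}) :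
    {set 'M[L]_n.+1} :=
  [set X | val P * X * (val P)^-1 \in mxset n.+1 Z].

Section StructureTheorem.
Variables (L : finFieldType) (n : nat).
Local Notation M := 'M[L]_n.+1.
Variable A : {set M}.
Hypotheses (subA : subring_set A) (spanA : spans A).

(** A spanning set of matrices is mapped by a surjective linear map to a spanning
set, out of which a basis can be extracted. *)
Lemma basis_of_span (phi : {linear M -> 'rV[L]_n.+1}) :
    (forall w, exists x, phi x = w) ->
  exists2 a : 'I_n.+1 -> M, (forall i, a i \in A) &
    \matrix_i phi (a i) \in unitmx.
Proof.
move=> phi_onto; pose N := \matrix_(i < #|A|) phi (enum_val i).
have phiN x : (phi x <= N)%MS.
  apply: (span_ind spanA (P := fun x => (phi x <= N)%MS)) x.
  - move=> x Ax.
    rewrite -(enum_rankK_in Ax Ax) -(rowK (fun i => phi (enum_val i))).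
    exact: row_sub.
  - by move=> x y Nx Ny; rewrite linearD addmx_sub.
  - by move=> c x Nx; rewrite linearZ scalemx_sub.
have fullN : row_full N.
  rewrite -sub1mx; apply/row_subP => i; have [x <-] := phi_onto (row i 1%:M).
  exact: phiN.
exists (fun i => enum_val (fullrankfun fullN i)); first by move=> i; apply: enum_valP.
suff <- : rowsub (fullrankfun fullN) N =
    \matrix_i phi (enum_val (fullrankfun fullN i)).
  exact: fullrowsub_unit.
by apply/row_matrixP=> i; rewrite row_rowsub !rowK.
Qed.

(** Write a primitive idempotent as [e = u *m v] with [v *m u = 1]. Then
[e A e = Z *: e] for a subfield [Z], which is the only invariant of [A] up to
conjugation: the rows [v *m a] with [a] in [A] contain a basis of the row space,
the columns [b *m u] with [b] in [A] a basis of the column space, and the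
product of such a row and such a column is in [Z]. *)
Lemma spanning_subring_conj :
  exists2 Z : {set L}, subring_set Z &
    exists P : {unit M}, A = conj_mxset Z P.
Proof.
have [A1 AD AM] := subA.
have [e prim_e] := primitive_idempotent_exists subA; have [Ae e_nz ee _] := prim_e.
have [u [v [def_e vu]]] := idempotent_rank1 e_nz ee (corner_comm subA spanA prim_e).
pose Z := [set z : L | z *: e \in A].
have subZ : subring_set Z.
  split=> [|x y|x y]; rewrite !inE ?scale1r // => Zx Zy.
    by rewrite scalerDl AD.
  by rewrite -ee -scalerA scalerAr scalerAl AM.
have Zva x : x \in A -> (v *m x *m u) 0 0 \in Z.
  move=> Ax; have defW : e * x * e = u *m (v *m x *m u) *m v.
    by rewrite {1 2}def_e -!mulmxE !mulmxA.
  rewrite inE; set W := v *m x *m u in defW *.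
  have -> : W 0 0 *: e = e * x * e; last by rewrite !AM.
  by rewrite defW [in RHS](mx11_scalar W) mul_mx_scalar -scalemxAl -def_e.
(* Dual bases: the rows v a_i of P and the columns b_j u of Q, whose pairing
   P Q has entries in Z. *)
have [|a Aa] := basis_of_span (phi := mulmx v).
  by move=> w; exists (u *m w); rewrite /= mulmxA vu mul1mx.
set P := \matrix_i _ => Pu.
have [|b Ab] := basis_of_span (phi := trmx \o mulmxr u).
  by move=> w; exists (w^T *m v); rewrite /= -mulmxA vu mulmx1 trmxK.
rewrite -unitmx_tr; set Q := _^T => Qu.
have colQ j : col j Q = b j *m u by rewrite -tr_row rowK /= trmxK.
have PXQ X i j : (P *m X *m Q) i j = (v *m (a i *m X *m b j) *m u) 0 0.
  have -> : (P *m X *m Q) i j = (row i (P *m X) *m col j Q) 0 0.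
    by rewrite !mxE; apply: eq_bigr => k _; rewrite !mxE.
  by rewrite row_mul rowK colQ !mulmxA.
have ZPXQ X : X \in A -> P *m X *m Q \in mxset n.+1 Z.
  by move=> AX; apply/mxsetP=> i j; rewrite PXQ Zva // !AM.
have subMZ : subring_set (mxset n.+1 Z) := subring_mxset n subZ.
have [_ _ ZMM] := subMZ.
have PQu : P *m Q \in unitmx by rewrite unitmx_mul Pu.
have ZPQ : invmx (P *m Q) \in mxset n.+1 Z.
  by apply: subring_setV => //; have := ZPXQ _ A1; rewrite mulmx1.
have defPV : invmx P = Q *m invmx (P *m Q).
  by apply: (can_inj (mulKmx Pu)); rewrite mulmxV // mulmxA mulmxV.
exists Z => //; exists (FinRing.unit _ (Pu : P \is a GRing.unit)).
(* X in A gives P X P^-1 = (P X Q) (P Q)^-1 in M_n(Z); conversely X is a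
   combination over Z of the b_j e a_i = col_j(Q) row_i(P). *)
apply/setP => X; rewrite inE -!mulmxE /= -[P^-1]/(invmx P).
apply/idP/idP => [AX|ZX].
  by rewrite defPV mulmxA ZMM // ZPXQ.
have -> : X = Q *m (invmx (P *m Q) *m (P *m X *m invmx P)) *m P.
  by rewrite mulmxA -defPV !mulmxA mulVmx // mul1mx mulmxKV.
set Y := invmx (P *m Q) *m _; have /mxsetP ZY : Y \in mxset n.+1 Z by apply: ZMM.
have -> : Q *m Y *m P = \sum_j \sum_i b j * (Y j i *: e) * a i.
  have YE i j : b j * (Y j i *: e) * a i = Y j i *: (col j Q *m row i P).
    by rewrite -scalerAr -scalerAl def_e colQ rowK -!mulmxE !mulmxA.
  apply/matrixP=> k l; rewrite mxE exchange_big /= summxE.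
  under [RHS]eq_bigr => i _.
    rewrite summxE; under eq_bigr => j _.
      rewrite YE mxE mul_col_rowE mulrCA mulrA.
      over.
    rewrite -mulr_suml.
    over.
  by apply: eq_bigr => i _; rewrite mxE.
apply: (subring_set_sum subA) => j; apply: (subring_set_sum subA) => i.
by rewrite !AM //; have := ZY j i; rewrite inE.
Qed.
End StructureTheorem.

(** * Algebras generated over a set of scalars *)

Section ScalarSets.
Variables (L : finFieldType).

(** Whether a set of matrices is an [F]-subalgebra depends on [F] only through
its image [C] in [L]. With sets of scalars in place of field morphisms, the
same notion covers the generation over [F] and over [L], and does not depend on
the choice of embeddings. *)
Definition subalgebra_over (C : {set L}) n (S : {set 'M[L]_n}) : bool :=
  [&& 1%:M \in S,
      [forall A in S, forall B in S, A + B \in S],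
      [forall A in S, forall B in S, A *m B \in S]
    & [forall c in C, forall A in S, c *: A \in S]].

Definition algebra_over (C : {set L}) n (X : {set 'M[L]_n}) : {set 'M[L]_n} :=
  \bigcap_(S : {set 'M[L]_n} | subalgebra_over C S && (X \subset S)) S.

Definition card_generating (C : {set L}) n m : nat :=
  #|[set t : m.-tuple 'M[L]_n | algebra_over C [set A in t] == setT]|.

Lemma g_card_generating (F : finFieldType) (iota : {rmorphism F -> L}) n m :
  g iota n m = card_generating [set x | x ^+ #|F| == x] n m.
Proof.
rewrite /g /card_generating; apply: eq_card => t; rewrite !inE /generates.
congr (_ == _); apply: eq_bigl => S; congr (_ && _).
rewrite /is_subalgebra /subalgebra_over -(imset_rmorph_fixed iota).
congr [&& _, _, _ & _]; apply/forallP/forall_inP => [cS _ /imsetP[c _ ->] | cS c].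
  exact: cS.
by apply: cS; rewrite imset_f.
Qed.

Section Positive.
Variables (C : {set L}) (n : nat).
Local Notation M := 'M[L]_n.+1.

Lemma subalgebra_overP (S : {set M}) :
  reflect (subring_set S /\ {in C & S, forall c A, c *: A \in S})
    (subalgebra_over C S).
Proof.
apply: (iffP and4P) => [|[[S1 SD SM] SZ]].
  move=> [S1 /forall_inP SD /forall_inP SM /forall_inP SZ].
  split=> [|c A Cc SA]; last exact: (forall_inP (SZ c Cc)).
  split=> // A B SA SB; first exact: (forall_inP (SD A SA)).
  exact: (forall_inP (SM A SA)).
split=> //; apply/forall_inP=> A SA; apply/forall_inP=> B SB.
- exact: SD.
- exact: SM.
- exact: SZ.
Qed.

Variable X : {set M}.

Lemma subalgebra_algebra_over : subalgebra_over C (algebra_over C X).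
Proof.
apply/subalgebra_overP; split; first split.
- by apply/bigcapP=> S /andP[/subalgebra_overP[[]]].
- move=> A B /bigcapP XA /bigcapP XB; apply/bigcapP=> S XS.
  have [/subalgebra_overP[[_ SD _] _] _] := andP XS.
  by rewrite SD ?XA ?XB.
- move=> A B /bigcapP XA /bigcapP XB; apply/bigcapP=> S XS.
  have [/subalgebra_overP[[_ _ SM] _] _] := andP XS.
  by rewrite SM ?XA ?XB.
move=> c A Cc /bigcapP XA; apply/bigcapP=> S XS.
have [/subalgebra_overP[_ SZ] _] := andP XS.
by rewrite SZ ?XA.
Qed.

Lemma sub_algebra_over : X \subset algebra_over C X.
Proof. by apply/bigcapsP=> S /andP[]. Qed.

Lemma algebra_over_min S :
  subalgebra_over C S -> X \subset S -> algebra_over C X \subset S.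
Proof. by move=> algS XS; apply: bigcap_inf; rewrite algS. Qed.

End Positive.

(** The span of a [C]-algebra over [L] is closed under products, hence is an
[L]-algebra; it contains [X], which generates everything over [L]. *)
Lemma spans_algebra_over n (C : {set L}) (X : {set 'M[L]_n.+1}) :
  algebra_over setT X = setT -> spans (algebra_over C X).
Proof.
move=> genX S AS SD SZ; set A := algebra_over C X in AS *.
have [[A1 AD AM] _] := subalgebra_overP _ _ (subalgebra_algebra_over C X).
pose V := <<enum A>>%VS.
have VS y : y \in V -> y \in S.
  move/coord_span=> ->.
  have S0 : 0 \in S by rewrite -(scale0r 1) SZ // (subsetP AS).
  elim/big_ind: _ => // i _.
  by rewrite SZ // (subsetP AS) // -mem_enum mem_nth // -cardE.
have AV x : x \in A -> x \in V by move=> Ax; rewrite memv_span // mem_enum.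
have VM x y : x \in V -> y \in V -> x * y \in V.
  move=> /coord_span-> /coord_span->.
  rewrite mulr_suml rpred_sum // => i _; rewrite mulr_sumr rpred_sum // => j _.
  rewrite -scalerAr -scalerAl !rpredZ // AV // AM // -mem_enum mem_nth // -cardE //.
suff TV : [set: 'M[L]_n.+1] \subset [set x | x \in V].
  by apply/setP=> x; rewrite inE VS //; have := subsetP TV x; rewrite !inE; apply.
rewrite -genX; apply: algebra_over_min.
  apply/subalgebra_overP; split; last by move=> c x _; rewrite !inE => /rpredZ->.
  split; first by rewrite inE AV.
    by move=> x y; rewrite !inE; apply: rpredD.
  by move=> x y; rewrite !inE; apply: VM.
by apply/subsetP=> x Xx; rewrite inE AV // (subsetP (sub_algebra_over C X)).
Qed.

End ScalarSets.

Lemma algebra_over_imset (K L : finFieldType) n (j : K -> L) (C : {set K})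
    (f : 'M[K]_n.+1 -> 'M[L]_n.+1) (X : {set 'M[K]_n.+1}) :
    f 1 = 1 -> {morph f : x y / x + y} -> {morph f : x y / x * y} ->
    (forall c A, f (c *: A) = j c *: f A) ->
  algebra_over (j @: C) (f @: X) = f @: algebra_over C X.
Proof.
move=> f1 fD fM fZ; apply/eqP; rewrite eqEsubset; apply/andP; split.
  have [[A1 AD AM] AZ] := subalgebra_overP _ _ (subalgebra_algebra_over C X).
  apply: algebra_over_min; last by rewrite imsetS // sub_algebra_over.
  apply/subalgebra_overP; split; first split.
  - by apply/imsetP; exists 1; rewrite ?f1.
  - by move=> _ _ /imsetP[x Ax ->] /imsetP[y Ay ->]; rewrite -fD imset_f ?AD.
  - by move=> _ _ /imsetP[x Ax ->] /imsetP[y Ay ->]; rewrite -fM imset_f ?AM.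
  by move=> _ _ /imsetP[c Cc ->] /imsetP[x Ax ->]; rewrite -fZ imset_f ?AZ.
have [[B1 BD BM] BZ] :=
  subalgebra_overP _ _ (subalgebra_algebra_over (j @: C) (f @: X)).
apply/subsetP=> _ /imsetP[x Ax ->]; set B := algebra_over _ _ in B1 BD BM BZ *.
suff /subsetP/(_ x Ax) : algebra_over C X \subset [set y | f y \in B] by rewrite inE.
apply: algebra_over_min.
  apply/subalgebra_overP; split; first split.
  - by rewrite inE f1.
  - by move=> y z; rewrite !inE fD; apply: BD.
  - by move=> y z; rewrite !inE fM; apply: BM.
  by move=> c y Cc; rewrite !inE fZ; apply: BZ; rewrite imset_f.
apply/subsetP=> y Xy; rewrite inE (subsetP (sub_algebra_over _ _)) //.
exact: imset_f.
Qed.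

(** * Counting the tuples that generate a conjugate *)

Lemma mem_scalar_conj_mxset (L : finFieldType) n (Z : {set L})
    (P : {unit 'M[L]_n.+1}) c :
  subring_set Z -> (c%:M \in conj_mxset Z P) = (c \in Z).
Proof.
move=> subZ; rewrite inE -mulmxE scalar_mxC mulmxE mulrK ?(valP P) //.
apply/mxsetP/idP => [/(_ 0 0)|Zc i k]; first by rewrite mxE eqxx.
by rewrite mxE; case: eqP => // _; apply: subring_set0.
Qed.

Lemma conj_mxset_inj (L : finFieldType) n (Z1 Z2 : {set L}) (P Q : {unit 'M[L]_n.+1}) :
  subring_set Z1 -> subring_set Z2 -> conj_mxset Z1 P = conj_mxset Z2 Q -> Z1 = Z2.
Proof.
move=> sub1 sub2 eqA; apply/setP=> c.
by rewrite -(mem_scalar_conj_mxset P) // eqA mem_scalar_conj_mxset.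
Qed.

(** The conjugates [P^-1 E_ij P] of the matrix units lie in [B] and form a basis. *)
Lemma sub_conj_mxset_full (L : finFieldType) n (Z : {set L}) (P : {unit 'M[L]_n.+1})
    (B : {set 'M[L]_n.+1}) :
  subring_set Z -> subalgebra_over setT B -> conj_mxset Z P \subset B -> B = setT.
Proof.
move=> subZ /subalgebra_overP[subB BZ] sZB; have [Z1 _ _] := subZ.
have UP := valP P; apply/setP=> Y; rewrite [RHS]inE.
have -> : Y = (val P)^-1 * (val P * Y * (val P)^-1) * val P.
  by rewrite !mulrA mulVr // mul1r mulrVK.
rewrite (matrix_sum_delta (val P * Y * _)) mulr_sumr mulr_suml.
apply: (subring_set_sum subB) => a; rewrite mulr_sumr mulr_suml.
apply: (subring_set_sum subB) => b; rewrite -scalerAr -scalerAl BZ ?inE //.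
rewrite (subsetP sZB) // inE !mulrA divrr // mul1r mulrK //.
by apply/mxsetP=> i k; rewrite mxE; case: (_ && _); rewrite ?subring_set0.
Qed.

Lemma mulmx_deltaE (R : pzSemiRingType) m n p (A : 'M[R]_(m, n)) i (k : 'I_p) a b :
  (A *m delta_mx i k) a b = A a i * (b == k)%:R.
Proof.
rewrite mxE (bigD1 i) //= big1 ?addr0 => [|l /negPf neq_li]; rewrite mxE ?eqxx //.
by rewrite neq_li mulr0.
Qed.

Lemma delta_mulmxE (R : pzSemiRingType) m n p (A : 'M[R]_(n, p)) (i : 'I_m) k a b :
  (delta_mx i k *m A) a b = (a == i)%:R * A k b.
Proof.
rewrite mxE (bigD1 k) //= big1 ?addr0 => [|l /negPf neq_lk];
  rewrite mxE ?eqxx ?andbT //.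
by rewrite neq_lk andbF mul0r.
Qed.

(** A central element commutes with the transvections [1 + E_ik], hence with the
matrix units [E_ik] for [i != k]. *)
Lemma center_GL (L : finFieldType) n (P : {unit 'M[L]_n.+1}) :
  (P \in 'Z([set: {unit 'M[L]_n.+1}]))%g = is_scalar_mx (val P).
Proof.
apply/centerP/is_scalar_mxP => [[_ cP]|[a def_P]]; last first.
  split; rewrite ?inE // => Q _; apply: val_inj.
  by rewrite /= def_P -!mulmxE scalar_mxC.
have comE i k : i != k -> val P * delta_mx i k = delta_mx i k * val P.
  move=> neq_ik; have EE : delta_mx i k * delta_mx i k = 0 :> 'M[L]_n.+1.
    by rewrite -mulmxE mul_delta_mx_0 // eq_sym.
  have U : 1 + delta_mx i k \is a @GRing.unit 'M[L]_n.+1.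
    apply/unitrP; exists (1 - delta_mx i k).
    rewrite !mulrDl !mulrDr !mulrN !mulNr EE !mul1r !mulr1 subr0 oppr0 addr0.
    by rewrite subrK addrK.
  have /(congr1 val) := cP (FinRing.unit _ U) (in_setT _).
  by rewrite /= mulrDl mulrDr mul1r mulr1 => /addrI.
have off k i : k != i -> val P k i = 0.
  move=> neq_ki; have := comE i k; rewrite eq_sym neq_ki => /(_ isT)/matrixP/(_ k k).
  by rewrite mulmx_deltaE delta_mulmxE eqxx (negPf neq_ki) mulr1 mul0r.
have diag i k : val P i i = val P k k.
  have [->//|neq_ik] := eqVneq i k.
  have := comE i k neq_ik => /matrixP/(_ i k).
  by rewrite mulmx_deltaE delta_mulmxE !eqxx mulr1 mul1r.
exists (val P 0 0); apply/matrixP=> i k; rewrite mxE.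
by have [->|neq_ik] := eqVneq i k; [rewrite (diag k 0) | rewrite (off i k neq_ik)].
Qed.

Section CountConjugates.
Variables (K L : finFieldType) (j : {rmorphism K -> L}) (n : nat).
Local Notation MK := 'M[K]_n.+1.
Local Notation ML := 'M[L]_n.+1.
Local Notation Z := (j @: [set: K]).
Implicit Types P Q : {unit ML}.

Lemma mxset_imset : mxset n.+1 Z = map_mx j @: [set: MK].
Proof.
apply/setP=> X; apply/mxsetP/imsetP => [ZX|[Y _ ->] a b]; last first.
  by rewrite mxE imset_f.
have jX a b : exists c, j c == X a b by have /imsetP[c _ ->] := ZX a b; exists c.
exists (\matrix_(a, b) xchoose (jX a b)) => //.
by apply/matrixP=> a b; rewrite !mxE (eqP (xchooseP (jX a b))).
Qed.

Definition jconj P (Y : MK) : ML := (val P)^-1 * map_mx j Y * val P.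

Lemma jconj_inj P : injective (jconj P).
Proof.
have PU := valP P; have PVU : (val P)^-1 \is a GRing.unit by rewrite unitrV.
by move=> X Y /(mulIr PU)/(mulrI PVU)/map_mx_inj.
Qed.

Lemma jconj_imset P : jconj P @: setT = conj_mxset Z P.
Proof.
apply/setP=> X; rewrite inE mxset_imset; apply/imsetP/imsetP=> -[Y _ defX];
  exists Y => //.
  by rewrite defX /jconj !mulrA divrr ?(valP P) // mul1r mulrK // (valP P).
by rewrite /jconj -defX !mulrA mulVr ?(valP P) // mul1r mulrVK // (valP P).
Qed.

Lemma algebra_over_jconj P (C : {set K}) (X : {set MK}) :
  algebra_over (j @: C) (jconj P @: X) = jconj P @: algebra_over C X.
Proof.
apply: algebra_over_imset => [|x y|x y|c x]; rewrite /jconj.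
- by rewrite rmorph1 mulr1 mulVr // (valP P).
- by rewrite rmorphD mulrDr mulrDl.
- by rewrite rmorphM !mulrA mulrK // (valP P).
by rewrite map_mxZ -scalerAr -scalerAl.
Qed.

(** Conjugation by [P] is an isomorphism from ['M[K]_n.+1] onto
[P^-1 'M[K]_n.+1 P], through which the two generation problems correspond. *)
Lemma card_generating_conj P (C : {set K}) m :
  #|[set t : m.-tuple ML | algebra_over (j @: C) [set A in t] == conj_mxset Z P]|
    = card_generating C n.+1 m.
Proof.
have map_inj : injective (map_tuple (n := m) (jconj P)).
  by move=> s t /(congr1 val)/(inj_map (@jconj_inj P))/val_inj.
rewrite /card_generating -(card_imset _ map_inj); apply: eq_card => t; rewrite !inE.
have mapE (s : m.-tuple MK) :
    [set A in map_tuple (jconj P) s] = jconj P @: [set A in s].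
  apply/setP=> A; rewrite inE; apply/mapP/imsetP=> -[B sB ->]; exists B => //.
    by rewrite inE.
  by rewrite inE in sB.
apply/eqP/imsetP => [genA|[s]]; last first.
  by rewrite inE => /eqP genK ->; rewrite mapE algebra_over_jconj genK jconj_imset.
have tP A : A \in t -> exists Y, jconj P Y == A.
  move=> tA; have : A \in conj_mxset Z P.
    by rewrite -genA (subsetP (sub_algebra_over _ _)) // inE.
  by rewrite -jconj_imset => /imsetP[Y _ ->]; exists Y.
pose s := [tuple xchoose (tP _ (mem_tnth i t)) | i < m].
have def_t : t = map_tuple (jconj P) s.
  apply: eq_from_tnth => i.
  by rewrite tnth_map tnth_mktuple (eqP (xchooseP (tP _ _))).
exists s => //; rewrite inE; apply/eqP/(imset_inj (@jconj_inj P)).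
by rewrite jconj_imset -algebra_over_jconj -mapE -def_t.
Qed.

End CountConjugates.

Section Normalizer.
Variables (K L : finFieldType) (j : {rmorphism K -> L}) (n : nat).
Local Notation MK := 'M[K]_n.+1.
Local Notation ML := 'M[L]_n.+1.
Local Notation Z := (j @: [set: K]).

Lemma map_mx_GL_unit (Q : {unit MK}) :
  (map_mx j (val Q) : ML) \is a GRing.unit.
Proof. by rewrite -[_ \is a _]/(_ \in unitmx) map_unitmx; apply: (valP Q). Qed.

Definition map_GL (Q : {unit MK}) : {unit ML} :=
  FinRing.unit _ (map_mx_GL_unit Q).

Lemma map_GL_inj : injective map_GL.
Proof. by move=> P Q /(congr1 val)/map_mx_inj/val_inj. Qed.

Lemma map_GLM : {morph map_GL : P Q / (P * Q)%g}.
Proof. by move=> P Q; apply: val_inj; rewrite /= rmorphM. Qed.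

Definition normalizer_mxset := [set P : {unit ML} | conj_mxset Z P == mxset n.+1 Z].

Lemma mem_conj_mxsetM (P Q : {unit ML}) X :
  (X \in conj_mxset Z (P * Q)%g) = (val Q * X * (val Q)^-1 \in conj_mxset Z P).
Proof. by rewrite !inE /= invrM ?(valP P) ?(valP Q) // !mulrA. Qed.

Lemma group_set_map_GL : group_set (map_GL @: setT).
Proof.
apply/group_setP; split=> [|_ _ /imsetP[P _ ->] /imsetP[Q _ ->]].
  by apply/imsetP; exists 1%g; rewrite ?inE //; apply: val_inj; rewrite /= rmorph1.
by rewrite -map_GLM imset_f.
Qed.

Lemma mem_map_GL (P : {unit ML}) : (P \in map_GL @: setT) = (val P \in mxset n.+1 Z).
Proof.
rewrite mxset_imset; apply/imsetP/imsetP=> [[Q _ ->]|[Y _ PY]]; first by exists (val Q).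
have UY : Y \is a GRing.unit.
  by have := valP P; rewrite /= PY -[_ \is a _]/(_ \in unitmx) map_unitmx.
by exists (FinRing.unit _ UY) => //; apply: val_inj.
Qed.

(** If [P] normalizes [M_n(Z)] and [c] is a nonzero entry of [P^-1], then the
entries of [P E_bk P^-1] show that [c *: P] has entries in [Z]. *)
Lemma normalizer_mxsetE :
  normalizer_mxset = ('Z([set: {unit ML}]) * (map_GL @: setT))%g.
Proof.
have subZ := subring_imset j; have subM := subring_mxset n subZ.
have [_ _ ZM] := subZ; have [_ _ MM] := subM.
apply/setP=> P; rewrite inE; apply/eqP/mulsgP => [conjP|[D Q]].
  pose P' := (val P)^-1; have PP' : val P * P' = 1 by rewrite divrr // (valP P).
  case: (pickP (fun kl => P' kl.1 kl.2 != 0)) => [[k l] P'kl | P'0]; last first.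
    have P'0' : P' = 0.
      by apply/matrixP=> a b; rewrite [RHS]mxE; apply/eqP/negbFE/(P'0 (a, b)).
    by move: PP'; rewrite P'0' mulr0 => /eqP; rewrite eq_sym oner_eq0.
  (* P E_bk P^-1 has (a, l) entry P_ab (P^-1)_kl. *)
  set c := P' k l in P'kl.
  have ZcP : c *: val P \in mxset n.+1 Z.
    apply/mxsetP=> a b; rewrite mxE.
    have : delta_mx b k \in conj_mxset Z P.
      rewrite conjP; apply/mxsetP=> x y; rewrite mxE.
      by case: (_ && _); rewrite ?subring_set0 //; have [] := subZ.
    rewrite inE => /mxsetP/(_ a l).
    by rewrite -!mulmxE mulmx_delta_mulmx mul_col_rowE mulrC.
  have UcP : c *: val P \is a GRing.unit.
    by rewrite scaler_unit ?unitfE // (valP P).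
  have UD : (c^-1)%:M \is a @GRing.unit ML.
    by rewrite -scalemx1 scaler_unit ?unitr1 // unitfE invr_eq0.
  exists (FinRing.unit _ UD) (FinRing.unit _ UcP).
  - by rewrite center_GL scalar_mx_is_scalar.
  - by rewrite mem_map_GL.
  by apply: val_inj; rewrite /= -mulmxE mul_scalar_mx scalerA mulVf // scale1r.
rewrite center_GL mem_map_GL => /is_scalar_mxP[c def_D] ZQ ->.
have UD := valP D; have UQ := valP Q.
have ZQV : (val Q)^-1 \in mxset n.+1 Z by apply: subring_setV.
apply/setP=> X; rewrite inE /= invrM // !mulrA.
have -> : val D * val Q * X * (val Q)^-1 * (val D)^-1 = val Q * X * (val Q)^-1.
  by rewrite def_D -!mulrA -mulmxE -scalar_mxC !mulmxE !mulrA mulrVK // -def_D.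
apply/idP/idP=> [ZX | ZX]; last by rewrite !MM.
have -> : X = (val Q)^-1 * (val Q * X * (val Q)^-1) * val Q.
  by rewrite !mulrA mulVr // mul1r mulrVK.
by rewrite MM // MM.
Qed.

(** The scalar matrices and the image of [GL_n(K)] intersect in the image of the
center of [GL_n(K)]. *)
Lemma card_normalizer_mxset :
  (#|normalizer_mxset| * #|'Z([set: {unit MK}])%g|
    = #|'Z([set: {unit ML}])%g| * #|[set: {unit MK}]|)%N.
Proof.
rewrite normalizer_mxsetE -[#|[set: {unit MK}]|](card_imset _ map_GL_inj).
have := mul_cardG 'Z([set: {unit ML}]) (group group_set_map_GL).
move=> /= ->; congr (_ * _)%N; rewrite -(card_imset _ map_GL_inj).
apply: eq_card => P; rewrite inE center_GL; apply/imsetP/andP => [[Q]|[]].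
  by rewrite center_GL => cQ ->; rewrite map_mx_is_scalar cQ imset_f.
move=> cP /imsetP[Q _ defP]; exists Q => //.
by rewrite center_GL -(map_mx_is_scalar j); rewrite defP in cP.
Qed.

(** Both sides count the pairs of an invertible [P] and a tuple that generates
[P^-1 M_n(K) P]: for a fixed tuple, the suitable [P] form a coset of the
normalizer. *)
Lemma card_tuples_conj_mxset (C : {set K}) m :
  (#|[set: {unit ML}]| * card_generating C n.+1 m =
   #|[set t : m.-tuple ML |
       [exists P, algebra_over (j @: C) [set A in t] == conj_mxset Z P]]|
     * #|normalizer_mxset|)%N.
Proof.
pose fits P (t : m.-tuple ML) :=
  algebra_over (j @: C) [set A in t] == conj_mxset Z P.
set G := [set t | _].
have fiber t : t \in G -> #|[set P | fits P t]| = #|normalizer_mxset|.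
  rewrite inE => /existsP[P0 /eqP P0t].
  rewrite -[RHS](card_imset _ (mulIg P0)); apply: eq_card => P.
  rewrite [LHS]inE /fits P0t; apply/eqP/imsetP => [eqP0|[Q]].
    exists (P * P0^-1)%g; last by rewrite mulgKV.
    rewrite inE; apply/eqP/setP=> X; rewrite mem_conj_mxsetM -eqP0 inE /= invrK.
    by rewrite !mulrA divrr ?(valP P0) // mul1r mulrK // (valP P0).
  rewrite inE => /eqP NQ ->; apply/setP=> X.
  by rewrite mem_conj_mxsetM NQ inE.
rewrite -sum_nat_const.
rewrite (eq_bigr (fun P => \sum_(t | fits P t) 1)%N); last first.
  by move=> P _; rewrite -(card_generating_conj j P) sum1dep_card.
rewrite (exchange_big_dep (mem G)) /=; last first.
  by move=> P t _ Pt; rewrite inE; apply/existsP; exists P.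
rewrite -sum_nat_const; apply: eq_bigr => t Gt.
by rewrite -(fiber t Gt) sum1dep_card; apply: eq_card => P; rewrite !inE.
Qed.

Lemma card_tuples_PGL (C : {set K}) m :
  (card_PGL n.+1 L * card_generating C n.+1 m =
   #|[set t : m.-tuple ML |
       [exists P, algebra_over (j @: C) [set A in t] == conj_mxset Z P]]|
     * card_PGL n.+1 K)%N.
Proof.
have PGLE (F : finFieldType) : (#|[set: {unit 'M[F]_n.+1}]| =
    card_PGL n.+1 F * #|'Z([set: {unit 'M[F]_n.+1}])%g|)%N.
  rewrite /card_PGL card_quotient; last by rewrite normal_norm ?center_normal.
  by rewrite mulnC Lagrange ?center_sub.
have := card_tuples_conj_mxset C m.
have := card_normalizer_mxset; rewrite !PGLE.
have := cardG_gt0 'Z([set: {unit ML}]); have := cardG_gt0 'Z([set: {unit MK}]).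
move: (card_PGL _ L) (card_PGL _ K) #|_| #|_| #|_| #|_| (card_generating _ _ _).
move=> gL gK G N zL zK c zK_gt0 zL_gt0.
rewrite mulnA => /eqP; rewrite eqn_pmul2r // => /eqP-> def_c.
apply/eqP; rewrite -(eqn_pmul2l zL_gt0); apply/eqP.
by rewrite mulnA [(zL * gL)%N]mulnC def_c mulnCA.
Qed.

End Normalizer.

(** * Summation over the subfields *)

(** A tuple that generates ['M[L]_n.+1] over [L] generates over [F] an algebra
conjugate to the matrices over a subfield of [L] containing [F]. That subfield
has order [q ^ s] for a unique divisor [s] of [r], and by [card_tuples_PGL] each
[s] accounts for one term. *)
Lemma sum_over_subfields (p e q n m r : nat) (L F : finFieldType)
    (K : nat -> finFieldType) (iota : {rmorphism F -> L}) :
    prime p -> (0 < e)%N -> q = (p ^ e)%N -> (0 < r)%N -> #|F| = q ->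
    #|L| = (q ^ r)%N -> (forall s, (s %| r)%N -> #|K s| = (q ^ s)%N) ->
  (card_generating [set: L] n.+1 m)%:R / (card_PGL n.+1 L)%:R =
  \sum_(s <- divisors r)
    (card_generating [set x : K s | x ^+ q == x] n.+1 m)%:R
      / (card_PGL n.+1 (K s))%:R
  :> rat.
Proof.
move=> p_pr e_gt0 q_eq r_gt0 cardF cardL cardK.
have q_gt1 : (1 < q)%N by rewrite -cardF finNzRing_gt1.
have PGL_nz (E : finFieldType) : (card_PGL n.+1 E)%:R != 0 :> rat.
  by rewrite pnatr_eq0 -lt0n cardG_gt0.
pose D := [set x : L | x ^+ q == x].
have defD : D = iota @: setT by rewrite imset_rmorph_fixed cardF.
have subD : subring_set D by rewrite defD; apply: subring_imset.
have cardD : #|D| = q by rewrite defD card_imset ?cardsT //; apply: fmorph_inj.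
pose Z s := [set x : L | x ^+ (q ^ s) == x].
(* The tuples whose F-algebra is conjugate to M_n of the subfield of order
   q^s; they do not depend on an embedding of K s. *)
pose gen s := [set t : m.-tuple 'M[L]_n.+1 |
  [exists P, algebra_over D [set A in t] == conj_mxset (Z s) P]].
have emb s : (s %| r)%N -> exists i : {rmorphism K s -> L}, True.
  move=> /dvdnP[k def_r]; apply: (finField_embedding (k := k)).
  by rewrite cardL cardK ?def_r ?dvdn_mull // mulnC expnM.
have defZ s (i : {rmorphism K s -> L}) : (s %| r)%N -> Z s = i @: setT.
  by move=> sr; rewrite imset_rmorph_fixed cardK.
have subZ s : (s %| r)%N -> subring_set (Z s).
  by move=> sr; have [i _] := emb s sr; rewrite (defZ s i sr); apply: subring_imset.
have cardZ s : (s %| r)%N -> #|Z s| = (q ^ s)%N.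
  move=> sr; have [i _] := emb s sr.
  by rewrite (defZ s i sr) card_imset ?cardsT ?cardK //; apply: fmorph_inj.
have count s : (s %| r)%N ->
    (card_generating [set x : K s | x ^+ q == x] n.+1 m)%:R
      / (card_PGL n.+1 (K s))%:R
    = #|gen s|%:R / (card_PGL n.+1 L)%:R :> rat.
  move=> sr; have [i _] := emb s sr; apply/eqP; rewrite eqr_div //; apply/eqP.
  have := card_tuples_PGL i n [set x | x ^+ q == x] m.
  rewrite -(defZ s i sr) (_ : i @: _ = D) => [eqc|]; first by rewrite -!natrM mulnC eqc.
  apply/setP=> x; apply/imsetP/idP => [[y]|Dx].
    by rewrite !inE => /eqP yq ->; rewrite -rmorphXn yq.
  have : x \in Z s.
    move: Dx; rewrite !inE => /eqP xq; elim: (s) => [|k /eqP IHk].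
      by rewrite expr1.
    by rewrite expnSr exprM IHk xq.
  rewrite (defZ s i sr) => /imsetP[y _ def_x]; exists y => //.
  by move: Dx; rewrite def_x !inE -rmorphXn (inj_eq (fmorph_inj i)).
rewrite (eq_big_seq (fun s => #|gen s|%:R / (card_PGL n.+1 L)%:R)); last first.
  by move=> s; rewrite -dvdn_divisors //; apply: count.
rewrite -mulr_suml; congr (_ / _); rewrite -natr_sum; congr (_%:R).
rewrite /card_generating -sum1_card big_mkcond /=.
under [RHS]eq_bigr => s _ do rewrite -sum1_card big_mkcond /=.
rewrite exchange_big /=; apply: eq_bigr => t _.
(* A tuple t lies in exactly one gen s if it generates over L, in none
   otherwise. *)
rewrite inE; case: eqP => [genT|ngenT].
  set A := algebra_over D [set A in t].
  have algA : subalgebra_over D A := subalgebra_algebra_over _ _.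
  have [subA AD] := subalgebra_overP _ _ algA; have [A1 _ _] := subA.
  have [Z0 subZ0 [P defA]] :=
    spanning_subring_conj subA (spans_algebra_over (C := D) genT).
  have sDZ0 : D \subset Z0.
    apply/subsetP=> c Dc.
    by rewrite -(mem_scalar_conj_mxset P) // -defA -scalemx1 AD.
  have [s sr cardZ0] :=
    card_subring_over p_pr e_gt0 q_eq cardL subZ0 subD cardD sDZ0.
  have defZ0 : Z0 = Z s by rewrite (subring_eq_fixed subZ0) cardZ0.
  rewrite (bigD1_seq s) ?divisors_uniq -?dvdn_divisors //= big1_seq => [|s'].
    rewrite ifT // inE; apply/existsP.
    by exists P; rewrite -/A defA defZ0.
  rewrite -dvdn_divisors // => /andP[neq_s's s'r]; rewrite ifF //; apply/negP.
  rewrite inE -/A => /existsP[Q /eqP]; rewrite defA defZ0.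
  move/conj_mxset_inj => /(_ (subZ s sr) (subZ s' s'r)).
  move/(congr1 (fun B => #|pred_of_set B|)).
  by rewrite !cardZ // => /eqP; rewrite eqn_exp2l // eq_sym (negPf neq_s's).
rewrite big1_seq // => s /=; rewrite -dvdn_divisors // => sr.
rewrite ifF //; apply/negP; rewrite inE => /existsP[P /eqP genP].
case: ngenT; set X := [set A in t] in genP *.
apply: (sub_conj_mxset_full (P := P) (subZ s sr)) (subalgebra_algebra_over _ _) _.
rewrite -genP; apply: algebra_over_min; last exact: sub_algebra_over.
have /subalgebra_overP[subB BZ] := subalgebra_algebra_over [set: L] X.
by apply/subalgebra_overP; split=> // c Y _; apply: BZ; rewrite inE.
Qed.

Unset Implicit Arguments.

Theorem theorem3p4 (p e q m n r : nat)
    (p_prime : prime p) (e_gt0 : (0 < e)%N) (q_eq : q = (p ^ e)%N)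
    (m_gt0 : (0 < m)%N) (n_gt0 : (0 < n)%N) (r_gt0 : (0 < r)%N)
    (Fq : finFieldType) (card_Fq : #|Fq| = q)
    (K : nat -> finFieldType)
    (card_K : forall s : nat, (s %| r)%N -> #|K s| = (q ^ s)%N)
    (iota : {rmorphism Fq -> K r}) :
  (g iota n m)%:R / (card_PGL n (K r))%:R =
  \sum_(s <- divisors r)
     (g (idfun : {rmorphism K s -> K s}) n m)%:R / (card_PGL n (K s))%:R
       * (mobius (r %/ s))%:~R
  :> rat.
Proof.
have card_idE s :
    g (idfun : {rmorphism K s -> K s}) n m = card_generating [set: K s] n m.
  rewrite g_card_generating; congr (card_generating _ _ _).
  by apply/setP=> x; rewrite !inE expf_card eqxx.
under eq_bigr => s _ do rewrite card_idE.
rewrite g_card_generating card_Fq.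
case: n n_gt0 {card_idE} => // n _.
apply: (mobius_inversion
  (a := fun s => (card_generating [set: K s] n.+1 m)%:R / (card_PGL n.+1 (K s))%:R)
  (b := fun s => (card_generating [set x : K s | x ^+ q == x] n.+1 m)%:R
                 / (card_PGL n.+1 (K s))%:R)) => // u ur.
have u_gt0 := dvdn_gt0 r_gt0 ur.
have [i _] : exists i : {rmorphism Fq -> K u}, True.
  by apply: (finField_embedding (k := u)); rewrite card_Fq card_K.
apply: (sum_over_subfields _ _ i p_prime e_gt0 q_eq) => // [|s su].
  exact: card_K.
by rewrite card_K // (dvdn_trans su).
Qed.
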